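(* Let $(A_\iota)_{\iota\in I}$ be a family of balloons, let $(E_\iota)_{\iota\in I}$ be the family of the corresponding equivalence relations, and let the index set $I$ be linearly ordered. Let $\mathcal{E}$ be the equivalence relation on the coproduct $A=\coprod_{\iota\in I}A_\iota$ which corresponds to the partition $(A_\iota)_{\iota\in I}$, let $p\colon A\to I$, $x\mapsto\iota$ for $x\in A_\iota$, be the natural projection, and let $R$ be the preference relation on $A$ defined by the rule \[ xRy \text{ if } \text{''}p(x)<p(y)\text{''} \text{ or } \text{''}p(x)=p(y)\text{ and } xE_{p(x)}y\text{''}. \] Then: (i) The asymmetric part $F=P_R$ of $R$ is negatively transitive and one has $\mathcal{E}=E_F$. (ii) The relation $R$ is weakly $\mathcal{E}$-saturated. (iii) The factor-set $A'=A/\mathcal{E}$ endowed with the weak factor-relation $R'$ of $R$ with respect to $\mathcal{E}$ is isomorphic to the linearly ordered set $I$.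
   Context: A preference relation (preorder) is a reflexive and transitive binary relation. A balloon is a non-empty set endowed with an equivalence relation. The coproduct of a family of pairwise disjoint sets is their union; the members $A_\iota$ are assumed pairwise disjoint (without loss of generality). For a binary relation $R$ on $A$: $R^{-1}$ is the inverse relation, $R^c$ the complement in $A^2$, $I_R=R\cap R^{-1}$, $P_R=R\setminus I_R$ is the asymmetric part, and $E_R=(R\cup R^{-1})^c$, i.e. $xE_Ry$ means neither $xRy$ nor $yRx$. $F$ is negatively transitive if $F^c$ is transitive, i.e. $xFz$ implies $xFy$ or $yFz$ for every $y\in A$. For an equivalence relation $\mathcal{E}$ on $A$ (class of $x$ denoted $\bar x$), $R$ is weakly $\mathcal{E}$-saturated if $xRy$ and $x'\mathcal{E}x$ imply that there exists $y'$ with $y'\mathcal{E}y$ and $x'Ry'$. The weak factor-relation $R'$ on $A/\mathcal{E}$ is defined by: $\bar xR'\bar y$ if for any $x'\in\bar x$ there exists $y'\in\bar y$ such that $x'Ry'$. *)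

(* Defs.v *)
From Stdlib Require Import Relations Ensembles FinFun Eqdep.

Set Implicit Arguments.
Unset Strict Implicit.

Section BinaryRelations.
Variable A : Type.
Implicit Types R F : relation A.

Definition rel_compl R : relation A := fun x y => ~ R x y.

Definition sym_part R : relation A := fun x y => R x y /\ transp A R x y.

Definition asym_part R : relation A := fun x y => R x y /\ ~ sym_part R x y.

Definition incomparability R : relation A :=
  rel_compl (union A R (transp A R)).

Definition negatively_transitive F : Prop := transitive A (rel_compl F).

End BinaryRelations.

Definition strict (I : Type) (le : relation I) : relation I :=
  fun i j => le i j /\ i <> j.

Definition linear_order (I : Type) (le : relation I) : Prop :=
  order I le /\ forall i j, le i j \/ le j i.

Definition isomorphic (X Y : Type) (RX : relation X) (RY : relation Y) : Prop :=
  exists f : X -> Y,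
    Bijective f /\ forall x x' : X, RX x x' <-> RY (f x) (f x').

Section Factor.
Variables (A : Type) (E : relation A).

Definition eq_class (x : A) : Ensemble A := fun y => E x y.

(* The factor-set: subsets of [A] that are classes of [E].  Equality of its
   elements is equality of subsets, by propositional and functional
   extensionality and proof irrelevance. *)
Definition factor_set : Type := {X : Ensemble A | exists x, X = eq_class x}.

Definition weakly_saturated (R : relation A) : Prop :=
  forall x y x' : A, R x y -> E x' x -> exists y' : A, E y' y /\ R x' y'.

Definition weak_factor (R : relation A) : relation factor_set :=
  fun X Y =>
    forall x', In A (proj1_sig X) x' ->
    exists y', In A (proj1_sig Y) y' /\ R x' y'.

End Factor.

Record balloon : Type := Balloon {
  carrier :> Type;
  balloon_rel : relation carrier;
  balloon_nonempty : inhabited carrier;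
  balloon_equiv : equivalence carrier balloon_rel
}.

Section Coproduct.
Variables (I : Type) (A : I -> balloon).

(* Disjoint union; the tag makes the members pairwise disjoint. *)
Definition coproduct : Type := {i : I & carrier (A i)}.

Definition inj (i : I) (a : A i) : coproduct := existT _ i a.

Definition proj (x : coproduct) : I := projT1 x.

(* [A i], seen as a subset of the coproduct. *)
Definition member (i : I) : Ensemble coproduct :=
  fun x => exists a : A i, x = inj a.

(* The relation of the balloon [A i], seen as a relation on the coproduct
   that holds only between elements of [member i]. *)
Definition member_rel (i : I) : relation coproduct :=
  fun x y => exists a b : A i, x = inj a /\ y = inj b /\ balloon_rel a b.

Definition partition_rel : relation coproduct :=
  fun x y => exists i, In coproduct (member i) x /\ In coproduct (member i) y.

Definition coproduct_pref (le : relation I) : relation coproduct :=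
  fun x y =>
    strict le (proj x) (proj y) \/
    (proj x = proj y /\ member_rel (proj x) x y).

Lemma partition_rel_equiv : equivalence coproduct partition_rel.
Proof.
split.
- intros [i a]; exists i; split; exists a; reflexivity.
- intros x y z [i [Hx [b Hy]]] [j [[b' Hy'] Hz]].
  assert (Hij : i = j).
  { rewrite Hy in Hy'. exact (f_equal proj Hy'). }
  subst j. exists i; split; [exact Hx | exact Hz].
- intros x y [i [Hx Hy]]; exists i; split; assumption.
Qed.

Lemma coproduct_pref_preorder (le : relation I) :
  linear_order le -> preorder coproduct (coproduct_pref le).
Proof.
intros [[_ Htr Has] _]; split.
- intros [i a]; right; split; [reflexivity |].
  exists a, a; repeat split.
  apply (equiv_refl _ _ (balloon_equiv (A i))).
- intros x y z [[Hxy Nxy] | [Exy Sxy]] [[Hyz Nyz] | [Eyz Syz]].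
  + left; split; [exact (Htr _ _ _ Hxy Hyz) |].
    intros Exz; rewrite Exz in Hxy.
    apply Nyz; apply Has; assumption.
  + left; rewrite <- Eyz; split; assumption.
  + left; rewrite Exy; split; assumption.
  + right; split; [congruence |].
    rewrite <- Exy in Syz.
    destruct Sxy as (a & b & Hx & Hy & Hab).
    destruct Syz as (b' & c & Hy' & Hz & Hbc).
    exists a, c; repeat split; try assumption.
    assert (Hb : b = b').
    { rewrite Hy in Hy'. exact (inj_pair2 _ _ _ _ _ Hy'). }
    subst b'.
    exact (equiv_trans _ _ (balloon_equiv (A (proj x))) _ _ _ Hab Hbc).
Qed.

End Coproduct.

(* Main.v *)
(** Each component of the statement only sees a point through its projection
    to [I]: the relation [E] is equality of projections, and, since each
    balloon carries a symmetric relation, the asymmetric part of [R] is the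
    strict order of projections. *)

Require Import Defs.
From Stdlib Require Import Relations Ensembles FinFun.
From Stdlib Require Import Classical IndefiniteDescription.
From Stdlib Require Import FunctionalExtensionality PropExtensionality.
From Stdlib Require Import ProofIrrelevance.

Section LinearOrder.
Set Implicit Arguments.
Variables (I : Type) (le : relation I).
Hypothesis hle : linear_order le.

(** Totality gives one direction and antisymmetry the other. Transitivity of the complement of
    [strict le] thereby becomes transitivity of [le]. *)
Lemma not_strict_iff (i j : I) : ~ strict le i j <-> le j i.
Proof.
destruct hle as [[Hrefl _ Hanti] Htot]; split.
- intros Hn; destruct (Htot i j) as [Hij | Hji]; [| exact Hji].
  destruct (classic (i = j)) as [-> | Hne]; [apply Hrefl |].
  now destruct Hn.
- intros Hji [Hij Hne]; now apply Hne, Hanti.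
Qed.

Lemma strict_negatively_transitive : negatively_transitive (strict le).
Proof.
intros i j k Hij Hjk; unfold rel_compl in *.
rewrite not_strict_iff in *.
destruct hle as [[_ Htrans _] _]; now apply Htrans with j.
Qed.

Lemma strict_incomparability (i j : I) :
  incomparability (strict le) i j <-> i = j.
Proof.
split.
- intros Hinc; destruct hle as [[_ _ Hanti] _].
  apply Hanti; apply not_strict_iff; intros Hs; apply Hinc; now [> right | left].
- intros -> [[_ Hne] | [_ Hne]]; now apply Hne.
Qed.

End LinearOrder.

Lemma factor_set_eq (A : Type) (E : relation A) (X Y : factor_set E) :
  (forall x, In A (proj1_sig X) x <-> In A (proj1_sig Y) x) -> X = Y.
Proof.
intros HXY; apply eq_sig_hprop; [intros; apply proof_irrelevance |].
apply functional_extensionality; intros x.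
apply propositional_extensionality, HXY.
Qed.

Section Coproduct.
Set Implicit Arguments.
Variables (I : Type) (A : I -> balloon).

(** Trades a statement about dependent pairs for an equation in [I], so that later arguments need no
    transport between balloons. *)
Lemma member_iff (i : I) (x : coproduct A) :
  In _ (member (A := A) i) x <-> proj x = i.
Proof.
split.
- now intros [a ->].
- destruct x as [j a]; cbn; intros <-; now exists a.
Qed.

Lemma partition_rel_iff (x y : coproduct A) :
  partition_rel x y <-> proj x = proj y.
Proof.
unfold partition_rel; split.
- intros [i Hi]; rewrite !member_iff in Hi; destruct Hi; congruence.
- intros Hxy; exists (proj y); now rewrite !member_iff.
Qed.

Lemma member_rel_sym (i : I) (x y : coproduct A) :
  member_rel i x y -> member_rel i y x.
Proof.
intros (a & b & Hx & Hy & Hab); exists b, a; repeat split; trivial.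
now apply (equiv_sym _ _ (balloon_equiv (A i))).
Qed.

Lemma member_nonempty (i : I) : exists x : coproduct A, proj x = i.
Proof.
destruct (balloon_nonempty (A i)) as [a]; now exists (inj a).
Qed.

Variable le : relation I.
Hypothesis hle : linear_order le.

Lemma coproduct_pref_le (x y : coproduct A) :
  coproduct_pref le x y -> le (proj x) (proj y).
Proof.
intros [[Hxy _] | [-> _]]; [exact Hxy |].
apply (ord_refl _ _ (proj1 hle)).
Qed.

Lemma asym_part_coproduct_pref (x y : coproduct A) :
  asym_part (coproduct_pref (A := A) le) x y <-> strict le (proj x) (proj y).
Proof.
split.
- intros [[Hs | [Heq Hm]] Hn]; [exact Hs |].
  (* Inside one balloon, symmetry of its relation puts the pair in the symmetric part, against
     [Hn]. *)
  destruct Hn; split; right; split; trivial.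
  + now symmetry.
  + rewrite <- Heq; now apply member_rel_sym.
- intros Hs; split; [now left |].
  intros [_ Hyx]; apply coproduct_pref_le in Hyx.
  now apply (not_strict_iff hle) in Hyx.
Qed.

Lemma coproduct_pref_weakly_saturated :
  weakly_saturated (partition_rel (A := A)) (coproduct_pref (A := A) le).
Proof.
intros x y x' Hxy Hx'; rewrite partition_rel_iff in Hx'.
destruct Hxy as [Hs | [Heq _]].
- exists y; rewrite partition_rel_iff; split; [reflexivity |].
  left; now rewrite Hx'.
(* The balloon's relation need not link [x'] to [y], but [x'] itself lies in the class of [y], and
   reflexivity suffices. *)
- exists x'; rewrite partition_rel_iff; split; [congruence |].
  apply (coproduct_pref_preorder A hle).
Qed.

Lemma member_eq_class (i : I) :
  exists x, member (A := A) i = eq_class (partition_rel (A := A)) x.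
Proof.
destruct (member_nonempty i) as [x Hx]; exists x.
apply functional_extensionality; intros y.
apply propositional_extensionality.
unfold eq_class; rewrite partition_rel_iff, Hx.
rewrite (member_iff i y); split; congruence.
Qed.

Definition member_class (i : I) : factor_set (partition_rel (A := A)) :=
  exist _ (member (A := A) i) (member_eq_class i).

(** A class only carries the bare existence of a representative, so one is chosen by description;
    [in_class_iff] shows that the choice does not matter. *)
Definition class_index (X : factor_set (partition_rel (A := A))) : I :=
  proj (proj1_sig (constructive_indefinite_description _ (proj2_sig X))).

Lemma in_class_iff (X : factor_set (partition_rel (A := A))) (y : coproduct A) :
  In _ (proj1_sig X) y <-> proj y = class_index X.
Proof.
unfold class_index.
destruct (constructive_indefinite_description _ (proj2_sig X)) as [x Hx]; cbn.
rewrite Hx; unfold In, eq_class; rewrite partition_rel_iff.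
split; congruence.
Qed.

Lemma class_index_bijective : Bijective class_index.
Proof.
exists member_class; split.
- intros X; apply factor_set_eq; intros x.
  rewrite (in_class_iff X); apply member_iff.
- intros i; destruct (member_nonempty i) as [x Hx].
  (* Only the right-hand [i] becomes [proj x]; the goal then says that [x] belongs to
     [member_class i]. *)
  rewrite <- Hx at 2; symmetry; rewrite <- in_class_iff.
  now apply member_iff.
Qed.

Lemma weak_factor_le (X Y : factor_set (partition_rel (A := A))) :
  weak_factor (coproduct_pref (A := A) le) X Y <->
  le (class_index X) (class_index Y).
Proof.
split.
(* Without a point in [X] the relation between classes would hold vacuously. *)
- intros HXY; destruct (member_nonempty (class_index X)) as [x Hx].
  destruct (HXY x) as (y & Hy & Hxy); [now apply in_class_iff |].
  rewrite in_class_iff in Hy; rewrite <- Hx, <- Hy.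
  now apply coproduct_pref_le.
- intros Hle x Hx; rewrite in_class_iff in Hx.
  (* Within one class [x] is its own witness by reflexivity; between distinct classes any point of
     the target balloon serves, and non-emptiness supplies one. *)
  destruct (classic (class_index X = class_index Y)) as [Heq | Hne].
  + exists x; rewrite in_class_iff; split; [congruence |].
    apply (coproduct_pref_preorder A hle).
  + destruct (member_nonempty (class_index Y)) as [y Hy].
    exists y; rewrite in_class_iff; split; [exact Hy |].
    left; rewrite Hx, Hy; now split.
Qed.

End Coproduct.

Theorem theorem2p2p1 (I : Type) (le : relation I) (hle : linear_order le)
    (A : I -> balloon) :
  let E : relation (coproduct A) := partition_rel (A := A) in
  let R : relation (coproduct A) := coproduct_pref (A := A) le in
  let F : relation (coproduct A) := asym_part R in
  (negatively_transitive F /\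
   same_relation (coproduct A) E (incomparability F)) /\
  weakly_saturated E R /\
  isomorphic (weak_factor (E := E) R) le.
Proof.
intros E R F.
assert (HF : forall x y, F x y <-> strict le (proj x) (proj y))
  by exact (asym_part_coproduct_pref hle).
(* Incomparability under [F] is that of the projections under [strict le], which for a linear order
   is equality. *)
assert (HE : forall x y, E x y <-> incomparability F x y).
{ intros x y; unfold E; rewrite partition_rel_iff.
  rewrite <- (strict_incomparability hle).
  unfold incomparability, rel_compl, union, transp; now rewrite !HF. }
split; [split |split].
- intros x y z; unfold rel_compl; rewrite !HF.
  apply (strict_negatively_transitive hle).
- split; intros x y; apply HE.
- now apply coproduct_pref_weakly_saturated.
- exists (@class_index I A); split.
  + apply class_index_bijective.
  + intros X Y; now apply weak_factor_le.
Qed.
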